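(* Let $n\ge 3$ and let $G$ be the transitive permutation group arising from $\mathrm{PSL}(2,3^n)$ acting on the left cosets of a subgroup of order $3$. Then $\rho(G)=3^{n-1}$ if $n$ is odd, and $\rho(G)=3^{n/2-1}$ if $n$ is even.
   Context: For a permutation group $G$ on a finite set $V$, a subset $\mathcal{F}\subseteq G$ is intersecting if for all $g,h\in\mathcal{F}$ there is $v\in V$ with $g(v)=h(v)$. The intersection density $\rho(G)$ is the maximum of $|\mathcal{F}|/\max\{|G_v|: v\in V\}$ over all intersecting sets $\mathcal{F}$ of $G$, where $G_v$ is the stabilizer of $v$. *)

(* Defs.v *)
From HB Require Import structures.
From mathcomp Require Import all_boot all_order all_algebra all_fingroup all_solvable.
Set Implicit Arguments. Unset Strict Implicit. Unset Printing Implicit Defensive.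
Import GRing.Theory.

Section SL2.
Variable F : finFieldType.

Definition SL2 : {set {'GL_2[F]}} := [set g : {'GL_2[F]} | (\det (GLval g) == 1)%R].

Lemma SL2_group_set : group_set SL2.
Proof.
apply/group_setP; split.
  by rewrite inE GL_1E det1.
move=> x y; rewrite !inE => /eqP dx /eqP dy.
by rewrite GL_MxE det_mulmx dx dy mulr1.
Qed.

Canonical SL2_group := Group SL2_group_set.

Definition PSL2 := (SL2 / 'Z(SL2))%g.
End SL2.

Section LeftCosetAction.
Variables (gT : finGroupType) (G H : {set gT}).

Definition lcoset_pts := {A : {set gT} | A \in lcosets H G}.

Definition lmul_act (g : gT) (A : lcoset_pts) : lcoset_pts :=
  if g \in G then insubd A (g *: val A)%g else A.

Definition lcoset_perm_group : {set {ffun lcoset_pts -> lcoset_pts}} :=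
  [set [ffun A => lmul_act g A] | g in G].
End LeftCosetAction.

Section Density.
Variable T : finType.
Implicit Types (P Fam : {set {ffun T -> T}}).

Definition intersecting Fam :=
  [forall f in Fam, forall g in Fam, exists v : T, f v == g v].

Definition stab P (v : T) := [set f in P | f v == v].

Definition int_density P : rat :=
  ((\max_(Fam : {set {ffun T -> T}} | (Fam \subset P) && intersecting Fam) #|Fam|)%:R
   / (\max_(v : T) #|stab P v|)%:R)%R.
End Density.

(* Main.v *)
Require Import Defs.
From HB Require Import structures.
From mathcomp Require Import all_boot all_order all_algebra all_fingroup all_solvable.
From mathcomp Require Import finfield ring zify.
Set Implicit Arguments. Unset Strict Implicit. Unset Printing Implicit Defensive.
Import GRing.Theory.

(* A set S is intersecting iff every g^-1 h with g, h in S is conjugate into H;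
   after a translation S contains 1, so that in characteristic 3 each element
   of S lifts to a unipotent matrix 1 + A of SL2. Comparing traces, two elements
   1 + A and 1 + A' of S satisfy tr (A A') = 0 or tr (A A') = 1. If some trace
   is 1, these equations leave room for at most 5 elements; otherwise S lies in
   a Sylow 3-subgroup, which is the additive group of the field F. There, being
   conjugate into H means being a square multiple of +b or -b, with b fixed. For
   n odd, -1 is a nonsquare and this is no restriction. For n even, S is a clique
   of the Paley graph, hence has size at most sqrt #|F|, a bound attained by the
   subfield of order sqrt #|F|. *)

(** * Intersecting sets of the coset action, read inside the group *)

Section CosetDensity.
Local Open Scope group_scope.
Variables (gT : finGroupType) (G H : {group gT}).
Hypothesis sHG : H \subset G.

(* [g] fixes a left coset of [H] in [G]. *)
Definition conj_into (g : gT) := [exists x in G, g ^ x \in H].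

(** By [act_meet] this is the intersecting property, transported from permutations to elements of
    [G]. *)
Definition meeting (S : {set gT}) := {in S &, forall g h, conj_into (g^-1 * h)}.

Let act (g : gT) : {ffun lcoset_pts G H -> lcoset_pts G H} :=
  [ffun A => lmul_act g A].

Lemma val_lmul_act g (A : lcoset_pts G H) :
  g \in G -> val (lmul_act g A) = g *: val A.
Proof.
move=> Gg; rewrite /lmul_act Gg val_insubd.
case: A => A /= /lcosetsP[x Gx ->].
by rewrite -lcosetM mem_lcosets mulGSid ?groupM.
Qed.

Lemma lcoset_ptP (A : lcoset_pts G H) : exists2 x, x \in G & val A = x *: H.
Proof. by case: A => A /= /lcosetsP. Qed.

Lemma lcoset_pt_of x : x \in G -> exists A : lcoset_pts G H, val A = x *: H.
Proof.
move=> Gx; have xP : x *: H \in lcosets H G by rewrite mem_lcosets mulGSid.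
by exists (exist (fun A => is_true (A \in lcosets H G)) _ xP).
Qed.

(** The cosets [g x H] and [h x H] agree iff [(g x)^-1 (h x)] lies in [H], and this product is
    [(g^-1 h) ^ x]. *)
Lemma act_eq g h (A : lcoset_pts G H) x :
  g \in G -> h \in G -> val A = x *: H ->
  (act g A == act h A) = ((g^-1 * h) ^ x \in H).
Proof.
move=> Gg Gh Ax; rewrite !ffunE -val_eqE /= !val_lmul_act // Ax -!lcosetM.
rewrite eq_sym.
have -> : ((g^-1 * h) ^ x \in H) = (h * x \in (g * x) *: H).
  by rewrite mem_lcoset invMg conjgE !mulgA.
exact/eqP/lcoset_eqP.
Qed.

Lemma act_meet g h : g \in G -> h \in G ->
  [exists A, act g A == act h A] = conj_into (g^-1 * h).
Proof.
move=> Gg Gh; apply/existsP/existsP => [[A]|[x /andP[Gx Hx]]].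
  have [x Gx Ax] := lcoset_ptP A; rewrite (act_eq Gg Gh Ax) => Hx.
  by exists x; rewrite Gx.
have [A Ax] := lcoset_pt_of Gx.
by exists A; rewrite (act_eq Gg Gh Ax).
Qed.

Hypothesis coreH : forall k, (forall x, x \in G -> k ^ x \in H) -> k = 1.

(** Faithfulness: if [g] and [h] act alike, all conjugates of [g^-1 h] lie in [H], and [coreH]
    applies. *)
Lemma act_inj : {in G &, injective act}.
Proof.
move=> g h Gg Gh eq_gh; apply/eqP; rewrite eq_mulVg1; apply/eqP/coreH => x Gx.
have [A Ax] := lcoset_pt_of Gx.
by rewrite -(act_eq Gg Gh Ax) eq_gh.
Qed.

(** The stabilizer of [x H] is the faithful image of [x H x^-1]. *)
Lemma card_stab_lcoset A : #|stab (lcoset_perm_group G H) A| = #|H|.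
Proof.
have [x Gx Ax] := lcoset_ptP A.
have sHx : H :^ x^-1 \subset G by rewrite -(conjGid (groupVr Gx)) conjSg.
have -> : stab (lcoset_perm_group G H) A = act @: (H :^ x^-1).
  apply/setP=> f; rewrite !inE; apply/andP/imsetP => [[/imsetP[g Gg ->]]|[g Hg ->]].
    move=> gA; exists g => //; rewrite mem_conjgV.
    have := act_eq (group1 G) Gg Ax; rewrite invg1 mul1g => <-.
    rewrite eq_sym -/(act g) (eqP gA) ffunE -val_eqE val_lmul_act //.
    by rewrite lcoset1.
  have Gg := subsetP sHx _ Hg; split; first by apply/imsetP; exists g.
  have := act_eq (group1 G) Gg Ax; rewrite invg1 mul1g -mem_conjgV Hg.
  by rewrite eq_sym => /eqP->; rewrite ffunE -val_eqE val_lmul_act // lcoset1.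
rewrite card_in_imset ?cardJg //.
by apply: sub_in2 act_inj; apply/subsetP.
Qed.

Lemma meeting_translate (S : {set gT}) g :
  meeting S -> meeting (g *: S).
Proof.
move=> mS _ _ /lcosetP[h Sh ->] /lcosetP[k Sk ->].
by rewrite invMg mulgA mulgKV mS.
Qed.

(** All stabilizers have order [#|H|], so only the numerator is at stake. Left translation keeps
    every [g^-1 h], hence the upper bound may assume that [S] contains 1. *)
Lemma int_density_coset m :
  (exists S : {set gT}, [/\ S \subset G, meeting S & #|S| = m]) ->
  (forall S : {set gT}, S \subset G -> 1 \in S -> meeting S -> #|S| <= m) ->
  int_density (lcoset_perm_group G H) = (m%:R / #|H|%:R)%R.
Proof.
move=> [S [sSG mS cS]] ub; congr (_%:R / _%:R)%R; apply/eqP; last first.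
  rewrite eqn_leq; apply/andP; split.
    by apply/bigmax_leqP=> A _; rewrite card_stab_lcoset.
  have [A _] := lcoset_pt_of (group1 G).
  by rewrite -(card_stab_lcoset A) leq_bigmax.
rewrite eqn_leq; apply/andP; split.
  apply/bigmax_leqP=> Fam /andP[sFam /forall_inP iFam].
  pose T := [set g in G | act g \in Fam].
  have sTG : T \subset G by apply/subsetP=> g; rewrite inE => /andP[].
  have -> : Fam = act @: T.
    apply/setP=> f; apply/idP/imsetP => [Ff|[g]]; last by rewrite inE => /andP[_ ?] ->.
    have /imsetP[g Gg ef] := subsetP sFam f Ff; exists g => //.
    by rewrite inE Gg; rewrite ef in Ff.
  rewrite card_in_imset; last by apply: sub_in2 act_inj; apply/subsetP.
  have mT : meeting T.
    move=> g h; rewrite !inE => /andP[Gg Fg] /andP[Gh Fh].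
    by rewrite -act_meet //; apply: (forall_inP (iFam _ Fg)).
  have [->|[g Tg]] := set_0Vmem T; first by rewrite cards0.
  have Gg := subsetP sTG g Tg.
  rewrite -(card_lcoset T g^-1) ub //; last exact: meeting_translate.
    by rewrite mul_subG ?sub1set ?groupV.
  by rewrite mem_lcoset invgK mulg1.
rewrite -cS -(card_in_imset (sub_in2 (subsetP sSG) act_inj)).
apply: leq_bigmax_cond; apply/andP; split.
  by apply/subsetP=> _ /imsetP[g Sg ->]; rewrite imset_f // (subsetP sSG).
apply/forall_inP=> _ /imsetP[g Sg ->]; apply/forall_inP=> _ /imsetP[h Sh ->].
by rewrite act_meet ?(subsetP sSG) //; apply: mS.
Qed.

End CosetDensity.

Local Open Scope ring_scope.

(** * Equations deduced as linear combinations of hypotheses *)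

Section LinearCombination.
Variable R : comNzRingType.
Implicit Types x y a b k : R.

(** The coefficients are supplied by hand, which leaves an identity for [ring] or [field]. *)
Lemma lincomb1 x y a b k : a = b -> x - y = k * (a - b) -> x = y.
Proof. by move=> ->; rewrite subrr mulr0 => /eqP; rewrite subr_eq0 => /eqP. Qed.

Lemma lincomb2 x y a1 b1 a2 b2 k1 k2 : a1 = b1 -> a2 = b2 ->
  x - y = k1 * (a1 - b1) + k2 * (a2 - b2) -> x = y.
Proof. by move=> -> e2 e; apply: (lincomb1 (k := k2) e2); rewrite e; ring. Qed.

Lemma lincomb3 x y a1 b1 a2 b2 a3 b3 k1 k2 k3 : a1 = b1 -> a2 = b2 -> a3 = b3 ->
  x - y = k1 * (a1 - b1) + k2 * (a2 - b2) + k3 * (a3 - b3) -> x = y.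
Proof.
move=> -> e2 e3 e; apply: (lincomb2 (k1 := k2) (k2 := k3) e2 e3).
by rewrite e; ring.
Qed.

End LinearCombination.

Arguments lincomb1 {R x y a b} k _ _.
Arguments lincomb2 {R x y a1 b1 a2 b2} k1 k2 _ _ _.
Arguments lincomb3 {R x y a1 b1 a2 b2 a3 b3} k1 k2 k3 _ _ _ _.

(** * Explicit two by two matrices *)

Section Matrix2.
Variable R : comNzRingType.

Definition mx2 (a b c d : R) : 'M[R]_2 :=
  \matrix_(i, j) if i == 0 then (if j == 0 then a else b)
                 else (if j == 0 then c else d).

Lemma mx2_eta (M : 'M[R]_2) : M = mx2 (M 0 0) (M 0 1) (M 1 0) (M 1 1).
Proof.
by apply/matrixP=> [[[|[|//]] i] [[|[|//]] j]]; rewrite !mxE /=;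
  congr (M _ _); apply: val_inj.
Qed.

Lemma mx2_inj a b c d a' b' c' d' : mx2 a b c d = mx2 a' b' c' d' ->
  [/\ a = a', b = b', c = c' & d = d'].
Proof.
move=> /matrixP eqM; have := (eqM 0 0, eqM 0 1, eqM 1 0, eqM 1 1).
by rewrite !mxE /= => -[[[]]].
Qed.

Lemma mul_mx2 a b c d a' b' c' d' : mx2 a b c d * mx2 a' b' c' d' =
  mx2 (a * a' + b * c') (a * b' + b * d') (c * a' + d * c') (c * b' + d * d').
Proof.
rewrite [LHS]mx2_eta; congr mx2; rewrite mxE !big_ord_recl big_ord0 !mxE /=; ring.
Qed.

Lemma opp_mx2 a b c d : - mx2 a b c d = mx2 (- a) (- b) (- c) (- d).
Proof. by rewrite [LHS]mx2_eta !mxE. Qed.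

Lemma sub_mx2 a b c d a' b' c' d' :
  mx2 a b c d - mx2 a' b' c' d' = mx2 (a - a') (b - b') (c - c') (d - d').
Proof. by rewrite [LHS]mx2_eta !mxE. Qed.

Lemma one_mx2 : 1 = mx2 1 0 0 1.
Proof. by rewrite [LHS]mx2_eta !mxE. Qed.

Lemma det_mx2 a b c d : \det (mx2 a b c d) = a * d - b * c.
Proof.
rewrite (expand_det_row _ 0) !big_ord_recl big_ord0 /cofactor !det_mx11 !mxE /=.
by rewrite expr0 expr1; ring.
Qed.

Lemma tr_mx2 a b c d : \tr (mx2 a b c d) = a + d.
Proof. by rewrite /mxtrace !big_ord_recl big_ord0 !mxE /= addr0. Qed.

End Matrix2.

(** * Elements of PSL2 as matrices of determinant 1 up to sign *)

Section PSL2.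
Variable F : finFieldType.
Implicit Types M N P : 'M[F]_2.

Local Notation Z := ('Z(SL2 F))%g.
Local Notation PSL := (SL2 F / Z)%G.

(** [insubd] makes the map total, with default 1 on singular matrices; it is meant for determinant
    1. *)
Definition psl M : coset_of Z := coset Z (insubd (1%g : {'GL_2[F]}) M).

Lemma GLval_insubd M : \det M = 1 -> GLval (insubd (1%g : {'GL_2[F]}) M) = M.
Proof. by move=> dM; apply: insubdK; rewrite unfold_in /= unitmxE dM unitr1. Qed.

Lemma insubd_SL2 M : \det M = 1 -> insubd (1%g : {'GL_2[F]}) M \in SL2 F.
Proof. by move=> dM; rewrite inE GLval_insubd ?dM. Qed.

Lemma insubd_normZ M : \det M = 1 -> insubd (1%g : {'GL_2[F]}) M \in 'N(Z)%g.
Proof. by move=> /insubd_SL2; apply: subsetP; apply: gFnorm. Qed.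

(** Commuting with the two elementary transvections forces a scalar matrix, and determinant 1 leaves
    the scalars 1 and -1. *)
Lemma center_SL2 (g : {'GL_2[F]}) :
  (g \in Z) = (GLval g == 1) || (GLval g == -1).
Proof.
apply/centerP/orP => [[] | gE].
  rewrite inE => dg cg.
  have comm M : \det M = 1 -> GLval g * M = M * GLval g.
    move=> dM; have := cg _ (insubd_SL2 dM).
    by move=> /(congr1 (@GLval _ _)); rewrite !GL_ME !GLval_insubd.
  have d1 : \det (mx2 1 1 0 1 : 'M[F]_2) = 1 by rewrite det_mx2; ring.
  have d2 : \det (mx2 1 0 1 1 : 'M[F]_2) = 1 by rewrite det_mx2; ring.
  move: dg (comm _ d1) (comm _ d2); rewrite (mx2_eta (GLval g)).
  move: (GLval g 0 0) (GLval g 0 1) (GLval g 1 0) (GLval g 1 1) => a b c d.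
  rewrite !det_mx2 !mul_mx2 => /eqP dg /mx2_inj[e5 e6 e7 e8] /mx2_inj[e1 e2 e3 e4].
  have b0 : b = 0 by apply: (lincomb1 1 e1); ring.
  have c0 : c = 0 by apply: (lincomb1 (-1) e5); ring.
  have ad : a = d by apply: (lincomb1 1 e6); ring.
  have : (a - 1) * (a + 1) == 0.
    by apply/eqP/(lincomb3 1 a b dg ad c0); ring.
  rewrite mulf_eq0 subr_eq0 addr_eq0 one_mx2 opp_mx2 oppr0 -ad b0 c0.
  by case/orP=> /eqP->; [left | right].
have dg : g \in SL2 F.
  rewrite inE; case: gE => /eqP->; rewrite ?det1 //.
  by rewrite one_mx2 opp_mx2 det_mx2; apply/eqP; ring.
split=> // h _; apply: (val_inj : injective (@GLval _ _)); rewrite !GL_ME.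
by case: gE => /eqP->; rewrite ?mul1r ?mulr1 ?mulN1r ?mulrN1.
Qed.

Lemma psl_eq M N : \det M = 1 -> \det N = 1 ->
  psl M = psl N <-> M = N \/ M = - N.
Proof.
move=> dM dN; have [nM nN] := (insubd_normZ dM, insubd_normZ dN).
split=> [/(rcoset_kercosetP nM nN)/rcosetP[z]|MN].
  rewrite center_SL2 => zE /(congr1 (@GLval _ _)); rewrite GL_ME !GLval_insubd //.
  by case/orP: zE => /eqP->; rewrite ?mul1r ?mulN1r; [left | right].
apply/(rcoset_kercosetP nM nN); rewrite mem_rcoset center_SL2 GL_ME GL_VE.
rewrite !GLval_insubd //.
have uN : N \in unitmx by rewrite unitmxE dN unitr1.
by case: MN => ->; rewrite ?mulNr (mulrV uN) eqxx ?orbT.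
Qed.

Lemma mem_psl M : \det M = 1 -> psl M \in PSL.
Proof. by move=> dM; apply/mem_quotient/insubd_SL2. Qed.

Lemma pslP g : g \in PSL -> exists2 M, \det M = 1 & g = psl M.
Proof.
case/morphimP=> x nx; rewrite inE => /eqP dx ->.
exists (GLval x) => //; congr (coset Z _); apply: val_inj.
by rewrite -[val (insubd _ _)]/(GLval _) GLval_insubd.
Qed.

Lemma psl1 : psl 1 = 1%g.
Proof.
rewrite -(morph1 (coset Z)); congr (coset Z _); apply: val_inj.
by rewrite -[val (insubd _ _)]/(GLval _) GLval_insubd ?det1.
Qed.

Lemma pslM M N : \det M = 1 -> \det N = 1 -> psl (M * N) = (psl M * psl N)%g.
Proof.
move=> dM dN; rewrite -[RHS]morphM ?insubd_normZ //; congr (coset Z _).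
apply: (val_inj : injective (@GLval _ _)).
by rewrite GL_ME !GLval_insubd // det_mulmx dM dN mulr1.
Qed.

Lemma psl_conj M N P : \det M = 1 -> \det N = 1 -> \det P = 1 ->
  M * P = P * N -> (psl M ^ psl P = psl N)%g.
Proof. by move=> dM dN dP e; rewrite conjgE -pslM // e pslM // mulKg. Qed.

(** In characteristic 3 the images of these matrices under [psl] form a Sylow 3-subgroup, a copy of
    the additive group of [F]. *)
Definition unip (y : F) := mx2 1 y 0 1.

Lemma det_unip y : \det (unip y) = 1.
Proof. by rewrite det_mx2; ring. Qed.

Lemma psl_unip0 : psl (unip 0) = 1%g.
Proof. by rewrite -psl1 one_mx2. Qed.

Lemma psl_unipD y z : psl (unip (y + z)) = (psl (unip y) * psl (unip z))%g.
Proof. by rewrite -pslM ?det_unip // mul_mx2; congr (psl (mx2 _ _ _ _)); ring. Qed.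

Lemma psl_unipV y z : ((psl (unip y))^-1 * psl (unip z))%g = psl (unip (z - y)).
Proof. by apply: (mulgI (psl (unip y))); rewrite mulKVg -psl_unipD subrKC. Qed.

Lemma psl_unipX y i : (psl (unip y) ^+ i)%g = psl (unip (y *+ i)).
Proof.
by elim: i => [|i IH]; rewrite ?expg0 ?psl_unip0 // expgS IH mulrS psl_unipD.
Qed.

Lemma unip_conj M : \det M = 1 -> \tr M = 2%:R ->
  exists P y, \det P = 1 /\ M * P = P * unip y.
Proof.
rewrite (mx2_eta M); move: (M 0 0) (M 0 1) (M 1 0) (M 1 1) => a b c d.
rewrite det_mx2 tr_mx2 => dM tM.
have dE : d = 2%:R - a by apply: (lincomb1 1 tM); ring.
have [c0 | nz_c] := eqVneq c 0.
  have a1 : a = 1.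
    have : (a - 1) * (a - 1) = 0 by apply: (lincomb3 (-1) a (- b) dM tM c0); ring.
    by move/eqP; rewrite mulf_eq0 orbb subr_eq0 => /eqP.
  exists 1, b; rewrite det1 mulr1 mul1r; split=> //.
  by rewrite dE a1 c0; congr mx2; ring.
(* The columns of [P] are the fixed vector [(M - 1) e1] and the multiple of [e1] that makes the
   determinant 1. *)
exists (mx2 (a - 1) (- c^-1) c 0), (- c^-1).
rewrite det_mx2 !mul_mx2; split; first by field.
congr mx2.
- by apply: (lincomb2 (-1) a dM tM); ring.
- by ring.
- by apply: (lincomb1 c tM); ring.
- by ring.
Qed.

End PSL2.

(** * Trace 2 lifts in characteristic 3 *)

Section Char3.
Variable F : finFieldType.
Hypothesis three0 : 3%:R = 0 :> F.
Local Notation Z := ('Z(SL2 F))%g.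
Local Notation PSL := (SL2 F / Z)%G.

Lemma two_neq0 : 2%:R != 0 :> F.
Proof.
apply/eqP=> two0; have := oner_neq0 F; apply/negP/negPn/eqP.
by apply: (lincomb2 1 (-1) three0 two0); ring.
Qed.

Lemma psl_tr2 (M N : 'M[F]_2) : \det M = 1 -> \det N = 1 -> \tr M = 2%:R ->
  psl M = psl N -> \tr N = 2%:R \/ \tr N = - 2%:R.
Proof.
move=> dM dN tM /(psl_eq dM dN)[] MN; rewrite -tM MN; first by left.
by right; rewrite raddfN opprK.
Qed.

(** If [M = - N], the traces give [2 = -2], which is impossible in characteristic 3. Hence a lift of
    trace 2 is unique. *)
Lemma psl_tr2_eq (M N : 'M[F]_2) : \det M = 1 -> \det N = 1 ->
  \tr M = 2%:R -> \tr N = 2%:R -> psl M = psl N -> M = N.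
Proof.
move=> dM dN tM tN /(psl_eq dM dN)[] // MN; case/negP: two_neq0.
move: tM; rewrite MN raddfN /= tN => e; apply/eqP.
by apply: (lincomb2 2%:R 1 three0 e); ring.
Qed.

Lemma tr_unip y : \tr (unip y) = 2%:R :> F.
Proof. by rewrite tr_mx2; ring. Qed.

Lemma psl_unip_inj : injective (fun y : F => psl (unip y)).
Proof.
move=> y z /psl_tr2_eq e.
by have /mx2_inj[] := e (det_unip _) (det_unip _) (tr_unip _) (tr_unip _).
Qed.

(** A lift has cube 1 or -1, so one of [M] and [- M] has cube 1. For that lift [N], Frobenius gives
    [(N - 1) ^+ 3 = N ^+ 3 - 1 = 0], and the vanishing of [\det (N - 1) = 2 - \tr N] gives the
    trace. *)
Lemma order3_lift g : g \in PSL -> (g ^+ 3 = 1)%g ->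
  exists M : 'M[F]_2, [/\ \det M = 1, \tr M = 2%:R & g = psl M].
Proof.
move=> /pslP[M dM ->] e.
have e3 : M ^+ 3 = 1 \/ (- M) ^+ 3 = 1.
  have : psl (M ^+ 3) = psl 1.
    by rewrite psl1 -e !exprS expr0 mulr1 !pslM ?det_mulmx ?dM ?mulr1 //.
  rewrite psl_eq ?det1 ?exprS ?expr0 ?mulr1 ?det_mulmx ?dM ?mulr1 //.
  case=> [->|E]; [by left | right].
  by rewrite !mulNr !mulrN !opprK E opprK.
have dN : \det (- M) = 1 by rewrite -scaleN1r detZ dM; ring.
have trM (N : 'M[F]_2) : \det N = 1 -> N ^+ 3 = 1 -> \tr N = 2%:R.
  move=> d1 N3; have : (N - 1) ^+ 3 = 0.
    have c3 : 3 \in [pchar 'M[F]_2].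
      by rewrite !inE /= -scaler_nat three0 scale0r.
    rewrite -(pFrobenius_autE c3) pFrobenius_autB_comm; last exact: commr1.
    by rewrite !pFrobenius_autE N3 expr1n subrr.
  move/(congr1 (@determinant _ _)); rewrite det0 !exprS expr0 mulr1 !det_mulmx.
  move/eqP; rewrite !mulf_eq0 !orbb; move: d1; rewrite (mx2_eta N).
  move: (N 0 0) (N 0 1) (N 1 0) (N 1 1) => a b c d.
  rewrite one_mx2 sub_mx2 !det_mx2 tr_mx2 => d1 /eqP d2.
  by apply: (lincomb2 1 (-1) d1 d2); ring.
case: e3 => e3; first by exists M; split=> //; apply: trM.
exists (- M); split=> //; first exact: trM.
by apply/psl_eq => //; right; rewrite opprK.
Qed.

End Char3.

(** * Squares in a finite field and the subfield of square root order *)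

Section Squares.
Variables (F : finFieldType).

Lemma expf_card_pred (x : F) : x != 0 -> x ^+ #|F|.-1 = 1.
Proof.
move=> nz_x; apply: (mulfI nz_x).
by rewrite -exprS prednK ?expf_card ?mulr1 //; apply/card_gt0P; exists 0.
Qed.

Lemma finField_prim_root : exists z : F, #|F|.-1.-primitive_root z.
Proof.
have F1 : (1 < #|F|)%N by exact: finNzRing_gt1.
have /hasP[z _ zP] : has #|F|.-1.-primitive_root (enum (predC1 (0 : F))).
  apply: has_prim_root; rewrite ?enum_uniq //; first by lia.
    apply/allP=> x; rewrite mem_enum inE => nz_x; apply/unity_rootP.
    exact: expf_card_pred.
  by rewrite -cardE cardC1.
by exists z.
Qed.

Lemma prim_root_pow (z x : F) :
  #|F|.-1.-primitive_root z -> x != 0 -> exists k, x = z ^+ k.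
Proof.
move=> zP nz_x.
by have [k ->] := prim_rootP zP (expf_card_pred nz_x); exists k.
Qed.

(** Here -1 is an odd power of a generator [z], with exponent [(q - 1) / 2]; so [y] or [- y] is an
    even power of [z]. *)
Lemma square_or_opp_square (y : F) :
  #|F| = 3 %[mod 4] -> exists s, y = s ^+ 2 \/ y = - s ^+ 2.
Proof.
move=> q3; have [->|nz_y] := eqVneq y 0; first by exists 0; left; rewrite expr0n.
have [z zP] := finField_prim_root; have [k ->] := prim_root_pow zP nz_y.
have zh : z ^+ (#|F|.-1 %/ 2) = -1.
  have : (z ^+ (#|F|.-1 %/ 2) - 1) * (z ^+ (#|F|.-1 %/ 2) + 1) == 0.
    rewrite -subr_sqr expr1n -exprM (_ : (_ * _)%N = #|F|.-1); last by lia.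
    by rewrite (prim_expr_order zP) subrr.
  rewrite mulf_eq0 subr_eq0 addr_eq0 => /orP[|/eqP//].
  by rewrite -(prim_order_dvd zP) => /dvdn_leq; lia.
have [[j kE]|[j kE]] :
  (exists j, k = j * 2)%N \/ (exists j, k + #|F|.-1 %/ 2 = j * 2)%N.
- have [odk|evk] := boolP (odd k).
    by right; exists ((k + #|F|.-1 %/ 2) %/ 2)%N; lia.
  by left; exists (k %/ 2)%N; lia.
- by exists (z ^+ j); left; rewrite kE exprM.
- by exists (z ^+ j); right; rewrite -exprM -kE exprD zh; ring.
Qed.

(** A generator is a nonsquare: its order is even, so no even power of it equals it. *)
Lemma exists_nonsquare : odd #|F| -> exists v : F, forall s, v <> s ^+ 2.
Proof.
move=> odF; have F1 : (1 < #|F|)%N by exact: finNzRing_gt1.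
have [z zP] := finField_prim_root; exists z => s zs.
have nz_s : s != 0.
  apply/eqP=> s0; have := prim_expr_order zP; rewrite zs s0 -exprM expr0n.
  by case: eqP => [|_ /eqP]; [lia | rewrite eq_sym oner_eq0].
have [k sk] := prim_root_pow zP nz_s.
have := eq_prim_root_expr zP 1 (k * 2); rewrite expr1 exprM -sk -zs eqxx.
by move=> /esym/eqP; lia.
Qed.

Variables (r : nat).
Hypotheses (r1 : (1 < r)%N) (odr : odd r) (qr : #|F| = (r * r)%N).
(** The fixed points of [y |-> y ^+ r], a Frobenius power once [r] is a power of the
    characteristic. *)
Definition subfield := [set y : F | y ^+ r == y].

Lemma pred_square_r : ((r * r).-1 = r.+1 * r.-1)%N.
Proof. by case: r r1 => // k _; rewrite mulSnr mulnS /=; lia. Qed.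

(** A nonzero [y = z ^+ k] has [y ^+ r.-1 = 1], so [r + 1] divides [k]; and [r + 1] is even. *)
Lemma subfield_square y : y \in subfield -> exists s, y = s ^+ 2.
Proof.
rewrite inE => /eqP yr; have [->|nz_y] := eqVneq y 0; first by exists 0; rewrite expr0n.
have [z zP] := finField_prim_root; have [k yk] := prim_root_pow zP nz_y.
have : y ^+ r.-1 == 1.
  by apply/eqP/(mulfI nz_y); rewrite -exprS prednK ?yr ?mulr1 //; lia.
rewrite yk -exprM -(prim_order_dvd zP) qr pred_square_r.
rewrite dvdn_pmul2r; last by lia.
move=> /dvdnP[j kE]; exists (z ^+ (j * (r.+1 %/ 2))).
have re : (r.+1 %/ 2 * 2 = r.+1)%N by lia.
by rewrite -exprM -mulnA re kE.
Qed.

Hypothesis charr : [pchar F].-nat r.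

Lemma subfieldB : {in subfield &, forall x y, x - y \in subfield}.
Proof.
move=> x y; rewrite !inE => /eqP xr /eqP yr.
by rewrite exprDn_pchar // exprNn_pchar // xr yr.
Qed.

Lemma natr_subfield i : i%:R \in subfield.
Proof.
rewrite inE; elim: i => [|i /eqP IH]; first by rewrite expr0n; case: r r1.
by rewrite -natr1 exprDn_pchar // IH expr1n.
Qed.

(** Zero and the powers of a primitive root of unity [w] of order [r - 1] are [r] fixed points. *)
Lemma card_subfield : (r <= #|subfield|)%N.
Proof.
have [z zP] := finField_prim_root.
have dv : (r.-1 %| #|F|.-1)%N by rewrite qr pred_square_r dvdn_mull.
have := dvdn_prim_root zP dv; move: (z ^+ _) => w wP.
have w1 : w ^+ r.-1 = 1 := prim_expr_order wP.
have nz_w : w != 0.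
  have r0 : (0 < r.-1)%N by lia.
  by have := oner_neq0 F; rewrite -w1 expf_eq0 r0.
rewrite (cardsD1 0) (_ : 0 \in subfield); last by rewrite (natr_subfield 0).
rewrite -[X in (X <= _)%N]prednK ?ltnS; last by lia.
have wr : w ^+ r = w.
  by rewrite -[r in LHS]prednK ?exprS ?w1 ?mulr1 //; lia.
pose f (j : 'I_r.-1) := w ^+ j.
have f_inj : injective f.
  move=> i j /eqP; rewrite (eq_prim_root_expr wP) !modn_small // => /eqP.
  exact: val_inj.
rewrite -[X in (X <= _)%N](card_ord r.-1) -(card_imset _ f_inj) subset_leq_card //.
apply/subsetP=> _ /imsetP[j _ ->]; rewrite !inE expf_neq0 //=.
by rewrite -exprM mulnC exprM wr.
Qed.

(* If [v] is not a square then (x, y) |-> x + v y is injective on Y * Y. *)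
Lemma paley_clique (b : F) (Y : {set F}) : odd #|F| -> b != 0 ->
  {in Y &, forall x y, exists s, x - y = b * s ^+ 2} -> (#|Y| * #|Y| <= #|F|)%N.
Proof.
move=> odF nz_b sqY; have [v nsq] := exists_nonsquare odF.
pose f (p : F * F) := p.1 + v * p.2; rewrite -cardsX.
suff f_inj : {in setX Y Y &, injective f} by rewrite -(card_in_imset f_inj) max_card.
move=> [x y] [x' y'] /setXP[/= Yx Yy] /setXP[/= Yx' Yy']; rewrite /f /= => e.
(* The second difference is taken as [y' - y], since [e] says [x - x' = v * (y' - y)]. *)
have [s xs] := sqY _ _ Yx Yx'; have [t yt] := sqY _ _ Yy' Yy.
have st : s ^+ 2 = v * t ^+ 2.
  apply: (mulfI nz_b); rewrite -xs mulrCA -yt.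
  by apply: (lincomb1 1 e); ring.
have t0 : t = 0.
  apply/eqP/negPn/negP => nz_t; apply: (nsq (s / t)).
  by rewrite expr_div_n st mulfK // expf_neq0.
have y0 : y' = y by apply: (lincomb2 1 (b * t) yt t0); ring.
by rewrite y0; congr (_, _); apply: (lincomb2 1 v e y0); ring.
Qed.
End Squares.

(** * Meeting sets for a subgroup of order 3 *)

Section Order3.
Variable F : finFieldType.
Hypothesis three0 : 3%:R = 0 :> F.
Local Notation Z := ('Z(SL2 F))%g.
Local Notation PSL := (SL2 F / Z)%G.
Variable H : {group coset_of Z}.
Hypotheses (sHG : H \subset PSL) (cH : #|H| = 3%N).

Lemma order3_conj : exists (P : 'M[F]_2) (b : F),
  [/\ \det P = 1, b != 0 & (H :^ psl P)%g = <[psl (unip b)]>%g].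
Proof.
have /trivgPn[h Hh nh1] : (H :!=: 1)%g by rewrite trivg_card1 cH.
have oh : #[h]%g = 3%N.
  have := order_dvdG Hh; rewrite cH => /(prime_nt_dvdP _); apply=> //.
  by rewrite order_eq1.
have defH : H :=: <[h]>%g.
  by apply/eqP; rewrite eq_sym eqEcard cycle_subG Hh cH -oh /=.
have [|M [dM tM hM]] := order3_lift three0 (subsetP sHG h Hh).
  by rewrite -oh expg_order.
have [P [b [dP MP]]] := unip_conj dM tM.
have hP : (h ^ psl P = psl (unip b))%g.
  by rewrite hM; apply: psl_conj => //; apply: det_unip.
exists P, b; split=> //; last by rewrite defH -cycleJ hP.
apply: contraNneq nh1 => b0.
by rewrite -(conjg_eq1 h (psl P)) hP b0 psl_unip0.
Qed.

Variables (P0 : 'M[F]_2) (b : F).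
Hypothesis dP0 : \det P0 = 1.
Hypothesis defH : (H :^ psl P0)%g = <[psl (unip b)]>%g.

(** Composing the conjugator with [psl P0] replaces [H] by the powers of [psl (unip b)]. *)
Lemma conj_intoP g : conj_into PSL H g <->
  exists (P : 'M[F]_2) (i : nat), \det P = 1 /\ (g ^ psl P)%g = psl (unip (b *+ i)).
Proof.
split=> [/exists_inP[x /pslP[Q dQ ->]] | [P [i [dP gP]]]].
  rewrite -(memJ_conjg _ (psl P0)) defH -conjgM -pslM // => /cycleP[i e].
  by exists (Q * P0), i; rewrite det_mulmx dQ dP0 mulr1 e psl_unipX.
apply/exists_inP; exists (psl P * (psl P0)^-1)%g.
  by rewrite groupM ?groupV ?mem_psl.
by rewrite -(memJ_conjg _ (psl P0)) defH -conjgM mulgKV gP -psl_unipX mem_cycle.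
Qed.

(** All conjugates of [k] are upper unitriangular up to sign. The Weyl element turns [unip y] into a
    lower unitriangular matrix, which forces [y = 0]. *)
Lemma order3_core k : (forall x, x \in PSL -> (k ^ x)%g \in H) -> k = 1%g.
Proof.
move=> kH.
have kJ (Q : 'M[F]_2) : \det Q = 1 -> exists y, (k ^ psl Q)%g = psl (unip y).
  move=> dQ; have : (k ^ (psl Q * (psl P0)^-1))%g \in H.
    by rewrite kH // groupM ?groupV ?mem_psl.
  rewrite -(memJ_conjg _ (psl P0)) defH -conjgM mulgKV => /cycleP[i e].
  by exists (b *+ i); rewrite e psl_unipX.
have [y ky] := kJ 1 (det1 _ _); rewrite psl1 conjg1 in ky.
have dw : \det (mx2 0 1 (-1) 0 : 'M[F]_2) = 1 by rewrite det_mx2; ring.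
have dl : \det (mx2 1 0 (- y) 1) = 1 by rewrite det_mx2; ring.
have [z kz] := kJ _ dw; rewrite ky in kz.
rewrite (@psl_conj _ _ (mx2 1 0 (- y) 1)) ?det_unip // in kz; last first.
  by rewrite !mul_mx2; congr mx2; ring.
have tl : \tr (mx2 1 0 (- y) 1) = 2%:R by rewrite tr_mx2; ring.
have [_ _ /eqP y0 _] := mx2_inj (psl_tr2_eq three0 dl (det_unip z) tl (tr_unip z) kz).
by rewrite ky -(opprK y) (eqP y0) oppr0 psl_unip0.
Qed.

Lemma conj_intoJ g (P : 'M[F]_2) :
  \det P = 1 -> conj_into PSL H g -> conj_into PSL H (g ^ psl P)%g.
Proof.
move=> dP /exists_inP[x Gx gx]; apply/exists_inP; exists ((psl P)^-1 * x)%g.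
  by rewrite groupM ?groupV ?mem_psl.
by rewrite -conjgM mulKVg.
Qed.

Lemma meetingJ (S : {set coset_of Z}) (P : 'M[F]_2) :
  \det P = 1 -> meeting PSL H S -> meeting PSL H (S :^ psl P)%g.
Proof.
move=> dP mS _ _ /imsetP[g Sg ->] /imsetP[h Sh ->].
by rewrite -conjVg -conjMg conj_intoJ ?mS.
Qed.

(* The matrix 1 + A with A = [[x, y], [z, -x]]; in [meet_trace], t = tr (A A'). *)
Definition unip3 (x y z : F) := mx2 (1 + x) y z (1 - x).

Lemma det_unip3 x y z : x * x + y * z = 0 -> \det (unip3 x y z) = 1.
Proof. by move=> e; rewrite det_mx2; apply: (lincomb1 (-1) e); ring. Qed.

Lemma conj_into_lift g : conj_into PSL H g ->
  exists x y z, x * x + y * z = 0 /\ g = psl (unip3 x y z).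
Proof.
case/conj_intoP=> P [i [dP gP]].
have gG : g = (psl (unip (b *+ i)) ^ (psl P)^-1)%g by rewrite -gP conjgK.
have [||M [dM tM ->]] := @order3_lift _ three0 g.
- by rewrite gG groupJ ?groupV ?mem_psl ?det_unip.
- rewrite gG -conjXg psl_unipX -(mulr_natr _ 3) three0.
  by rewrite mulr0 psl_unip0 conj1g.
move: dM tM; rewrite (mx2_eta M).
move: (M 0 0) (M 0 1) (M 1 0) (M 1 1) => a c d e; rewrite det_mx2 tr_mx2 => dM tM.
exists (a - 1), c, d; split; first by apply: (lincomb2 (-1) a dM tM); ring.
by congr (psl (mx2 _ _ _ _)); [ring | apply: (lincomb1 1 tM); ring].
Qed.

(** As [A] has square 0, the inverse of [1 + A] is [1 - A], and [(1 - A) (1 + A')] has trace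
    [2 - t]. This must be 2 or -2, and [4 = 1] in [F]. *)
Lemma meet_trace x y z x' y' z' :
  x * x + y * z = 0 -> x' * x' + y' * z' = 0 ->
  conj_into PSL H ((psl (unip3 x y z))^-1 * psl (unip3 x' y' z'))%g ->
  let t := 2%:R * x * x' + y * z' + z * y' in t = 0 \/ t = 1.
Proof.
move=> e e' D t.
have dA := det_unip3 e; have dA' := det_unip3 e'.
have dV : \det (mx2 (1 - x) (- y) (- z) (1 + x)) = 1.
  by rewrite det_mx2; apply: (lincomb1 (-1) e); ring.
have VE : (psl (unip3 x y z))^-1%g = psl (mx2 (1 - x) (- y) (- z) (1 + x)).
  apply/eqP; rewrite eq_invg_mul -pslM // mul_mx2 -psl1 one_mx2; apply/eqP.
  by congr (psl (mx2 _ _ _ _)); try (by ring); apply: (lincomb1 (-1) e); ring.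
have [x1 [y1 [z1 [e1]]]] := conj_into_lift D.
rewrite VE -pslM // => /esym/psl_tr2; move: (det_unip3 e1) => dA1.
case=> //; rewrite ?det_mulmx ?dV ?dA' ?mulr1 // ?tr_mx2; first by ring.
  rewrite mul_mx2 tr_mx2 => E; left; apply: (lincomb1 (-1) E); rewrite /t; ring.
rewrite mul_mx2 tr_mx2 => E; right; apply: (lincomb2 (-1) 1 E three0); rewrite /t; ring.
Qed.

Lemma sqrt_opp1_sign : exists j : F, forall u, u * u = -1 -> u = j \/ u = - j.
Proof.
have [/existsP[j /eqP jj] | no] := boolP [exists j : F, j * j == -1]; last first.
  (* Without a square root of -1 the value 0 is arbitrary. *)
  by exists 0 => u uu; case/existsP: no; exists u; rewrite uu.
exists j => u uu; have : (u - j) * (u + j) == 0.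
  by apply/eqP/(lincomb2 1 (-1) uu jj); ring.
by rewrite mulf_eq0 subr_eq0 addr_eq0 => /orP[]/eqP; [left | right].
Qed.

Lemma conj_into1 (T : {set coset_of Z}) g :
  meeting PSL H T -> 1%g \in T -> g \in T -> conj_into PSL H g.
Proof. by move=> mT T1 Tg; have := mT _ _ T1 Tg; rewrite invg1 mul1g. Qed.

Lemma unip3_upper x y z : x * x + y * z = 0 -> z = 0 -> unip3 x y z = unip y /\ x = 0.
Proof.
move=> e z0; have x0 : x = 0.
  by move/eqP: e; rewrite z0 mulr0 addr0 mulf_eq0 orbb => /eqP.
by split=> //; rewrite x0 z0 /unip3 addr0 subr0.
Qed.

(** Pairing with [unip c] gives [c * z = 0] or [c * z = 1]. If some element has [z = c^-1], pairing
    with it pins down all the others. *)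
Lemma meeting_unip (T : {set coset_of Z}) c :
  meeting PSL H T -> 1%g \in T -> c != 0 -> psl (unip c) \in T ->
  (#|T| <= 5)%N \/ forall g, g \in T -> exists y, g = psl (unip y).
Proof.
move=> mT T1 nz_c Tc.
have e0 (y : F) : 0 * 0 + y * 0 = 0 by ring.
have uE (y : F) : unip y = unip3 0 y 0 by rewrite /unip3 addr0 subr0.
have zE x y z : x * x + y * z = 0 -> psl (unip3 x y z) \in T -> z = 0 \/ z = c^-1.
  move=> e Tg; have := mT _ _ Tc Tg; rewrite uE => /(meet_trace (e0 c) e)[] E; [left|right].
    by apply: (mulfI nz_c); apply: (lincomb1 1 E); ring.
  by apply: (mulfI nz_c); rewrite divff //; apply: (lincomb1 1 E); ring.
have yE x y : x * x + y * c^-1 = 0 -> y = - (c * x * x).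
  by move=> e; apply: (lincomb1 c e); field.
have [/forall_inP all_u | ] := boolP [forall g in T, [exists y, g == psl (unip y)]].
  by right=> g /all_u/existsP[y /eqP]; exists y.
rewrite negb_forall_in => /exists_inP[g2 Tg2 nu]; left.
have [x [y [z [e g2E]]]] := conj_into_lift (conj_into1 mT T1 Tg2).
rewrite {}g2E in Tg2 nu.
have [z0|{}zc] := zE _ _ _ e Tg2.
  by case/existsP: nu; exists y; rewrite (unip3_upper e z0).1.
rewrite {}zc in e Tg2 nu; rewrite {y e nu}(yE _ _ e) in Tg2 *.
have e2 (u : F) : u * u + (- (c * u * u)) * c^-1 = 0 by field.
have [j jP] := sqrt_opp1_sign.
pose E u := psl (unip3 u (- (c * u * u)) c^-1).
(* Elements with [z = 0] have [y = 0] or [y = c]. Those with [z = c^-1] are the [E x'], where [E x]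
   and [E x'] pair to [- (x' - x) ^+ 2]; so [x' - x] is 0 or a square root of -1. *)
pose s := [:: psl (unip 0); psl (unip c); E x; E (x + j); E (x - j)].
apply: leq_trans (card_size s); apply/subset_leq_card/subsetP => g Tg.
have [x' [y' [z' [e' gE]]]] := conj_into_lift (conj_into1 mT T1 Tg).
rewrite {g}gE in Tg *.
have D := meet_trace (e2 x) e' (mT _ _ Tg2 Tg).
have [z0|zc] := zE _ _ _ e' Tg.
  have [-> x0] := unip3_upper e' z0.
  case: D => D.
    have -> : y' = 0; last by rewrite inE eqxx.
    by apply: (mulfI (invr_neq0 nz_c)); rewrite x0 z0 in D; apply: (lincomb1 1 D); ring.
  have -> : y' = c; last by rewrite !inE eqxx orbT.
  apply: (mulfI (invr_neq0 nz_c)); rewrite mulVf //.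
  by rewrite x0 z0 in D; apply: (lincomb1 1 D); ring.
rewrite {Tg z'}zc in e' D *; rewrite {y' e'}(yE _ _ e') in D *; rewrite -/(E x').
case: D => D.
  have : (x' - x) * (x' - x) == 0 by apply/eqP/(lincomb1 (-1) D); field.
  by rewrite mulf_eq0 orbb subr_eq0 => /eqP->; rewrite !inE eqxx !orbT.
have /jP[] : (x' - x) * (x' - x) = -1 by apply: (lincomb1 (-1) D); field.
  by move/eqP; rewrite subr_eq addrC => /eqP->; rewrite !inE eqxx !orbT.
by move/eqP; rewrite subr_eq addrC => /eqP->; rewrite !inE eqxx !orbT.
Qed.

(** A nontrivial element of [S] is conjugated to some [psl (unip c)], and [meeting_unip] applies to
    the conjugate of [S]. *)
Lemma meeting_dichotomy (S : {set coset_of Z}) : meeting PSL H S -> 1%g \in S ->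
  (#|S| <= 5)%N \/ exists2 P : 'M[F]_2, \det P = 1 &
    forall g, g \in (S :^ psl P)%g -> exists y, g = psl (unip y).
Proof.
move=> mS S1; have [S1E | ] := eqVneq S [set 1%g].
  by left; rewrite S1E cards1.
rewrite eqEsubset sub1set S1 andbT => /subsetPn[g Sg]; rewrite inE => ng1.
have [x [y [z [e gE]]]] := conj_into_lift (conj_into1 mS S1 Sg).
have dM := det_unip3 e; have [|P [c [dP MP]]] := unip_conj dM.
  by rewrite tr_mx2; ring.
have gP : (g ^ psl P = psl (unip c))%g.
  by rewrite gE; apply: psl_conj => //; apply: det_unip.
have [||||le5|all_u] := @meeting_unip (S :^ psl P)%g c.
- exact: meetingJ.
- by rewrite -(conj1g (psl P)) memJ_conjg.
- apply: contraNneq ng1 => c0.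
  by rewrite -(conjg_eq1 g (psl P)) gP c0 psl_unip0.
- by rewrite -gP memJ_conjg.
- by left; rewrite -(cardJg S (psl P)).
by right; exists P.
Qed.

(** Conjugating [unip c] back by [P] gives the matrix [N], with corner [p ^+ 2 * c]. By uniqueness
    of the trace 2 lift, [N = unip y]. *)
Lemma conj_into_unip_square y : (forall i, exists s : F, i%:R = s ^+ 2) ->
  conj_into PSL H (psl (unip y)) -> exists s, y = b * s ^+ 2.
Proof.
move=> sq /conj_intoP[P [i [dP uP]]]; have [s si] := sq i.
move: dP uP; rewrite -mulr_natr (mx2_eta P); set c := b * _.
move: (P 0 0) (P 0 1) (P 1 0) (P 1 1) => p q r w dP uP.
exists (s * p); pose N := mx2 (1 - p * r * c) (p * p * c) (- (r * r * c)) (1 + p * r * c).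
have dN : \det N = 1 by rewrite det_mx2; ring.
have tN : \tr N = 2%:R by rewrite tr_mx2; ring.
have NP : (psl N ^ psl (mx2 p q r w) = psl (unip c))%g.
  apply: psl_conj; rewrite ?det_unip // !mul_mx2; rewrite det_mx2 in dP.
  congr mx2; try by ring.
    by apply: (lincomb1 (p * c) dP); ring.
  by apply: (lincomb1 (r * c) dP); ring.
rewrite -uP in NP; have /psl_tr2_eq := conjg_inj _ NP.
move=> /(_ three0 dN (det_unip y) tN (tr_unip y)) /mx2_inj[_ <- _ _].
by rewrite /c si; ring.
Qed.

(** Conjugation by the diagonal matrix of [s] and [s^-1] scales the corner by a square; for [s = 0]
    the element is 1. *)
Lemma unip_conj_into s i : conj_into PSL H (psl (unip (b * s ^+ 2 *+ i))).
Proof.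
apply/conj_intoP; have [->|nz_s] := eqVneq s 0.
  exists 1, 0%N; rewrite det1 psl1 conjg1 mulr0n expr0n /= mulr0 mul0rn.
  by split.
have dP : \det (mx2 s 0 0 s^-1) = 1 by rewrite det_mx2; field.
exists (mx2 s 0 0 s^-1), i; split=> //.
apply: psl_conj; rewrite ?det_unip // !mul_mx2 -(mulr_natr (b * _) i) -(mulr_natr b i).
by congr mx2; field.
Qed.

Lemma meeting_unip_set (Y : {set F}) :
  {in Y &, forall y z, conj_into PSL H (psl (unip (z - y)))} ->
  let S := [set psl (unip y) | y in Y] in
  [/\ S \subset PSL, meeting PSL H S & #|S| = #|Y|].
Proof.
move=> mY S; split; last by rewrite card_imset //; apply: psl_unip_inj.
  by apply/subsetP=> _ /imsetP[y _ ->]; rewrite mem_psl ?det_unip.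
by move=> _ _ /imsetP[y Yy ->] /imsetP[z Yz ->]; rewrite psl_unipV mY.
Qed.

(** The bound [5 <= m] absorbs the small case of the dichotomy; otherwise a conjugate of [S] is the
    image of a set of field elements. *)
Lemma meeting_upper (m : nat) (S : {set coset_of Z}) : (5 <= m)%N ->
  (forall Y : {set F}, {in Y &, forall y z, conj_into PSL H (psl (unip (z - y)))} ->
    (#|Y| <= m)%N) ->
  meeting PSL H S -> 1%g \in S -> (#|S| <= m)%N.
Proof.
move=> m5 ub mS S1; have [le5|[P dP all_u]] := meeting_dichotomy mS S1.
  exact: leq_trans m5.
pose Y := [set y | psl (unip y) \in (S :^ psl P)%g].
rewrite -(cardJg S (psl P)).
have -> : (S :^ psl P)%g = [set psl (unip y) | y in Y].
  apply/setP=> g; apply/idP/imsetP => [Sg|[y]]; last by rewrite inE => ? ->.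
  by have [y gy] := all_u _ Sg; exists y; rewrite // inE -gy.
apply: leq_trans (leq_imset_card _ _) _; apply: ub => y z; rewrite !inE => Sy Sz.
by rewrite -psl_unipV; apply: (meetingJ dP mS).
Qed.

End Order3.

(* The value of the density, by the parity of [n] *)
Local Close Scope ring_scope.

Theorem theorem7p2 (n : nat) (F : finFieldType)
    (H : {group coset_of 'Z(SL2 F)}) :
  3 <= n -> #|F| = 3 ^ n ->
  H \subset PSL2 F -> #|H| = 3 ->
  int_density (lcoset_perm_group (PSL2 F) H) =
    ((if odd n then 3 ^ (n - 1) else 3 ^ (n./2 - 1))%:R : rat).
Proof.
Local Open Scope ring_scope.
move=> n3 qE sHG cH.
have char3 : 3%N \in [pchar F] by apply: (card_finPcharP qE).
have three0 : 3%:R = 0 :> F by apply: pcharf0 char3.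
have [P0 [b [dP0 nz_b defH]]] := order3_conj three0 sHG cH.
have odF : odd #|F| by rewrite qE oddX orbT.
have core := order3_core three0 dP0 defH.
(* The largest size of a meeting set; dividing it by [#|H| = 3] lowers the exponent by one. *)
pose m := if odd n then (3 ^ n)%N else (3 ^ n./2)%N.
have -> : (if odd n then 3 ^ (n - 1) else 3 ^ (n./2 - 1))%N%:R =
    m%:R / #|H|%:R :> rat.
  have div3 k : (0 < k)%N -> (3 ^ (k - 1))%N%:R = (3 ^ k)%N%:R / 3%:R :> rat.
    by case: k => // k _; rewrite subSS subn0 expnS natrM mulrC mulKf.
  by rewrite cH /m; case: ifP => _; apply: div3; lia.
(* From [3 <= n], the exponent in [m] is at least 2. *)
have m5 : (5 <= m)%N.
  have le9 k : (1 < k)%N -> (5 <= 3 ^ k)%N.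
    by move=> k1; apply: (@leq_trans (3 ^ 2)); rewrite ?leq_exp2l.
  by rewrite /m; case: ifP => ?; apply: le9; lia.
suff [[Y mY cY] ub] : (exists2 Y : {set F},
      {in Y &, forall y z, conj_into (SL2 F / 'Z(SL2 F))%G H (psl (unip (z - y)))} &
      (m <= #|Y|)%N) /\
    (forall Y : {set F},
      {in Y &, forall y z, conj_into (SL2 F / 'Z(SL2 F))%G H (psl (unip (z - y)))} ->
      (#|Y| <= m)%N).
  apply: (int_density_coset (G := (SL2 F / 'Z(SL2 F))%G)) => //.
    have [sS mS cS] := meeting_unip_set three0 mY.
    exists [set psl (unip y) | y in Y]; split=> //.
    by rewrite cS; apply/eqP; rewrite eqn_leq cY ub.
  by move=> S _ S1 mS; apply: (meeting_upper three0 dP0 defH m5 ub mS S1).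
rewrite /m; case: ifP => odn.
  split=> [|Y _]; last by rewrite -qE max_card.
  exists setT; last by rewrite cardsT qE.
  (* For [n] odd, [3 ^ n] is 3 modulo 4, because 9 is 1 modulo 4. *)
  move=> y z _ _; have [|s] := @square_or_opp_square F ((z - y) / b).
    rewrite qE -(odd_double_half n) odn -muln2 mulnC expnS expnM.
    by rewrite -modnMmr -modnXm exp1n.
  have zE u : (z - y) / b = u -> z - y = b * u by move<-; field.
  case=> /zE->; first exact: (unip_conj_into dP0 defH s 1).
  (* In characteristic 3, [-1 = 2]: the opposite of a square uses the second power of the
     generator. *)
  have -> : b * - s ^+ 2 = b * s ^+ 2 *+ 2; last exact: (unip_conj_into dP0 defH).
  by apply: (lincomb1 (- (b * s ^+ 2)) three0); ring.
pose r := (3 ^ n./2)%N.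
have r1 : (1 < r)%N by rewrite -(expn0 3) ltn_exp2l //; lia.
have qr : #|F| = (r * r)%N.
  by rewrite qE -expnD addnn -[n in LHS]odd_double_half odn.
have odr : odd r by rewrite oddX orbT.
have charr : [pchar F].-nat r by rewrite pnatX pnatE ?char3.
(* The prime field lies in the subfield of order [r], all of whose elements are squares in [F]. *)
have natsq i : exists s : F, i%:R = s ^+ 2.
  by apply: (subfield_square r1 odr qr); apply: natr_subfield.
split=> [|Y mY].
  (* Differences in this set are [b] times subfield elements, hence [b] times squares. *)
  exists [set b * k | k in subfield F r].
    move=> _ _ /imsetP[y Ky ->] /imsetP[z Kz ->]; rewrite -mulrBr.
    have [s ->] := subfield_square r1 odr qr (subfieldB charr Kz Ky).
    exact: (unip_conj_into dP0 defH s 1).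
  by rewrite card_imset ?card_subfield //; apply: mulfI.
rewrite -leq_sqr -!mulnn -qr; apply: (paley_clique odF nz_b) => y z Yy Yz.
exact: (conj_into_unip_square three0 dP0 defH natsq (mY _ _ Yz Yy)).
Qed.
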